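(* For all integers $\alpha\ge 1$ and $n\ge 0$, \[\overline{p}\big(5^{2\alpha+1}(5n+1)\big)\equiv \overline{p}\big(5^{2\alpha+1}(5n+4)\big)\equiv 0 \pmod 5.\]
   Context: An overpartition of a nonnegative integer $n$ is a partition of $n$ in which the first occurrence of each distinct part may (or may not) be overlined; $\overline{p}(n)$ denotes the number of overpartitions of $n$ (with $\overline{p}(0)=1$). Equivalently, $\sum_{n\ge0}\overline{p}(n)q^n=\prod_{k\ge1}\frac{1+q^k}{1-q^k}$. *)

(* Defs.v *)
From mathcomp Require Import all_boot.
Set Implicit Arguments. Unset Strict Implicit. Unset Printing Implicit Defensive.

(* An overpartition of n is a partition of n (a nonincreasing sequence of
   positive parts summing to n) in which the first occurrence of each distinct
   part may or may not be overlined.  We represent an overpartition as a pair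
   (s, o) where s is the partition (nonincreasing) and o is the (decreasingly
   sorted) list of distinct part values whose first occurrence is overlined;
   o is any subsequence of undup s. *)

Fixpoint parts_bounded (fuel n m : nat) : seq (seq nat) :=
  match fuel with
  | 0 => if n == 0 then [:: [::]] else [::]
  | fuel'.+1 =>
      if n == 0 then [:: [::]]
      else flatten [seq [seq k :: s | s <- parts_bounded fuel' (n - k) k]
                   | k <- iota 1 (minn n m)]
  end.

Definition partitions (n : nat) : seq (seq nat) := parts_bounded n n n.

Fixpoint subseqs (s : seq nat) : seq (seq nat) :=
  match s with
  | [::] => [:: [::]]
  | x :: t => [seq x :: u | u <- subseqs t] ++ subseqs t
  end.

Definition overpartitions (n : nat) : seq (seq nat * seq nat) :=
  flatten [seq [seq (s, o) | o <- subseqs (undup s)] | s <- partitions n].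

Definition pbar (n : nat) : nat := size (overpartitions n).

Example pbar_small : [seq pbar i | i <- iota 0 6] = [:: 1; 2; 4; 8; 14; 24].
Proof. by vm_compute. Qed.

Example parts_ok : all (fun s => (sumn s == 7) && sorted geq s && all (leq 1) s) (partitions 7)
  && uniq (partitions 7) && (size (partitions 7) == 15).
Proof. by vm_compute. Qed.

(* Main.v *)
From HB Require Import structures.
Require Import Defs.
From mathcomp Require Import all_boot all_order all_algebra.
From mathcomp Require Import boolp zify ring.

(* Let theta(q) = sum_x (-1)^x q^(x^2), so that sum_n pbar(n) q^n = 1/theta by Gauss's
   identity, for which Shanks's finite form is used.  Over F_5 one has theta^5 = F with
   F(q) = theta(q^5), hence F / theta = theta^4.  Write theta = t0 + t1 + t4 according to
   exponents modulo 5; then t0 = F(q^5).  Division by 2 + i and 2 - i in the Gaussian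
   integers gives r_2(5n) + r_2(n/5) = 2 r_2(n), i.e. t1 t4 = F^2 - t0^2.  Consequently
   the exponents divisible by 5 in theta^4 contribute F^4, so that
   pbar(5n) = [q^n] theta^3, and [q^(25n)] theta^3 = [q^n] (2 theta^3 - theta F^2).
   The exponents congruent to 1 or 4 modulo 5 in theta^3 contribute 3 t1 F^2 and 3 t4 F^2,
   so that the latter coefficient vanishes when n = 1, 4 mod 5; the exponents divisible
   by 5 contribute t0 F^2, so that it equals [q^n] theta^3 when 5 divides n. *)

Set Implicit Arguments. Unset Strict Implicit. Unset Printing Implicit Defensive.
Import GRing.Theory.
Local Open Scope ring_scope.

(** * Formal power series *)

Record pseries (R : Type) := PSeries { pcoef :> nat -> R }.

HB.instance Definition _ (R : Type) := gen_eqMixin (pseries R).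
HB.instance Definition _ (R : Type) := gen_choiceMixin (pseries R).

Lemma pseriesP (R : Type) (f g : pseries R) : f =1 g -> f = g.
Proof. by case: f g => [f] [g] /= /funext ->. Qed.

Section SeriesRing.
Variable R : comNzRingType.
Implicit Types f g h : pseries R.

Definition ps_zero : pseries R := PSeries (fun=> 0).
Definition ps_opp f : pseries R := PSeries (fun n => - f n).
Definition ps_add f g : pseries R := PSeries (fun n => f n + g n).

Fact ps_addA : associative ps_add.
Proof. by move=> f g h; apply: pseriesP => n /=; rewrite addrA. Qed.
Fact ps_addC : commutative ps_add.
Proof. by move=> f g; apply: pseriesP => n /=; rewrite addrC. Qed.
Fact ps_add0 : left_id ps_zero ps_add.
Proof. by move=> f; apply: pseriesP => n /=; rewrite add0r. Qed.
Fact ps_addN : left_inverse ps_zero ps_opp ps_add.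
Proof. by move=> f; apply: pseriesP => n /=; rewrite addNr. Qed.

HB.instance Definition _ :=
  GRing.isZmodule.Build (pseries R) ps_addA ps_addC ps_add0 ps_addN.

Definition ps_one : pseries R := PSeries (fun n => (n == 0)%:R).
Definition ps_mul f g : pseries R :=
  PSeries (fun n => \sum_(i < n.+1) f i * g (n - i)%N).

(** Coefficients of a product up to degree n depend only on these truncations, so associativity and
    commutativity of [ps_mul] are inherited from polynomials. *)
Definition trunc (n : nat) f : {poly R} := \poly_(i < n.+1) f i.

Lemma coef_trunc n f k : (k <= n)%N -> (trunc n f)`_k = f k.
Proof. by move=> le_kn; rewrite coef_poly ltnS le_kn. Qed.

Lemma coef_ps_mul n f g k : (k <= n)%N ->
  ps_mul f g k = (trunc n f * trunc n g)`_k.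
Proof.
move=> le_kn; rewrite coefM; apply: eq_bigr => i _.
have le_ik : (i <= k)%N by rewrite -ltnS.
by rewrite !coef_trunc //; lia.
Qed.

Lemma coefM_ext (p q p' q' : {poly R}) n :
  (forall k, (k <= n)%N -> p`_k = p'`_k) -> (forall k, (k <= n)%N -> q`_k = q'`_k) ->
  (p * q)`_n = (p' * q')`_n.
Proof.
move=> ep eq; rewrite !coefM; apply: eq_bigr => i _.
by rewrite ep ?eq ?leq_subr // -ltnS.
Qed.

Lemma trunc_mul n f g k : (k <= n)%N ->
  (trunc n (ps_mul f g))`_k = (trunc n f * trunc n g)`_k.
Proof. by move=> le_kn; rewrite coef_trunc // (coef_ps_mul _ _ le_kn). Qed.

Fact ps_mulA : associative ps_mul.
Proof.
move=> f g h; apply: pseriesP => n; rewrite !(coef_ps_mul _ _ (leqnn n)).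
rewrite (coefM_ext (p' := trunc n f) (q' := trunc n g * trunc n h)) //.
  by rewrite mulrA; apply: coefM_ext => // k; move/trunc_mul.
by move=> k /trunc_mul.
Qed.

Fact ps_mulC : commutative ps_mul.
Proof.
by move=> f g; apply: pseriesP => n; rewrite !(coef_ps_mul _ _ (leqnn n)) mulrC.
Qed.

Fact ps_mul1 : left_id ps_one ps_mul.
Proof.
move=> f; apply: pseriesP => n /=; rewrite big_ord_recl /= mul1r subn0.
by rewrite big1 ?addr0 // => i _; rewrite mul0r.
Qed.

Fact ps_mulDl : left_distributive ps_mul ps_add.
Proof.
move=> f g h; apply: pseriesP => n /=; rewrite -big_split /=.
by apply: eq_bigr => i _; rewrite mulrDl.
Qed.

Fact ps_one_neq0 : ps_one != 0.
Proof.
apply/eqP => /(congr1 (fun f : pseries R => f 0%N)) /= /eqP.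
by rewrite oner_eq0.
Qed.

HB.instance Definition _ := GRing.Zmodule_isComNzRing.Build (pseries R)
  ps_mulA ps_mulC ps_mul1 ps_mulDl ps_one_neq0.

Lemma psD f g n : (f + g) n = f n + g n. Proof. by []. Qed.
Lemma psN f n : (- f) n = - f n. Proof. by []. Qed.
Lemma psB f g n : (f - g) n = f n - g n. Proof. by []. Qed.
Lemma ps0 n : (0 : pseries R) n = 0. Proof. by []. Qed.
Lemma ps1 n : (1 : pseries R) n = (n == 0)%:R. Proof. by []. Qed.
Lemma psM f g n : (f * g) n = \sum_(i < n.+1) f i * g (n - i)%N.
Proof. by []. Qed.

Lemma ps_sum (I : Type) (r : seq I) (P : pred I) (F : I -> pseries R) n :
  (\sum_(i <- r | P i) F i) n = \sum_(i <- r | P i) F i n.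
Proof. by apply: (big_morph (fun f : pseries R => f n)). Qed.

Lemma ps_natr m n : (m%:R : pseries R) n = (n == 0)%:R *+ m.
Proof. by elim: m => [|m IHm]; rewrite ?mulr0n // !mulrS psD IHm. Qed.

Lemma psM_ext f g f' g' n : (forall k, (k <= n)%N -> f k = f' k) ->
  (forall k, (k <= n)%N -> g k = g' k) -> (f * g) n = (f' * g') n.
Proof.
move=> ef eg; rewrite !psM; apply: eq_bigr => i _.
by rewrite ef ?eg ?leq_subr // -ltnS.
Qed.

Definition psX (k : nat) : pseries R := PSeries (fun n => (n == k)%:R).

Lemma psXE k n : psX k n = (n == k)%:R. Proof. by []. Qed.

Lemma psXM k f n : (psX k * f) n = if (k <= n)%N then f (n - k)%N else 0.
Proof.
rewrite psM; case: leqP => [le_kn | lt_nk].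
  have lt_kn : (k < n.+1)%N by [].
  rewrite (bigD1 (Ordinal lt_kn)) //= eqxx mul1r big1 ?addr0 // => i.
  by rewrite -val_eqE /= => /negPf ->; rewrite mul0r.
rewrite big1 // => i _ /=; have := ltn_ord i.
by rewrite ltnS => /leq_ltn_trans/(_ lt_nk)/ltn_eqF ->; rewrite mul0r.
Qed.

Lemma psX0 : psX 0 = 1. Proof. by []. Qed.

Lemma psXD j k : psX (j + k) = psX j * psX k.
Proof.
apply: pseriesP => n; rewrite psXM !psXE; case: leqP => [le_jn | lt_nj].
  by congr ((_ : bool)%:R); lia.
by have -> : (n == j + k)%N = false by lia.
Qed.

Lemma psXX j k : psX j ^+ k = psX (k * j).
Proof. by elim: k => [|k IHk]; rewrite ?expr0 ?mul0n ?psX0 // exprS IHk mulSn psXD. Qed.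

(** The difference h satisfies h = q^k h with k > 0, so each of its coefficients is 0 or equal to an
    earlier one, and strong induction kills them all. *)
Lemma ps_subXI k f g : (0 < k)%N -> (1 - psX k) * f = (1 - psX k) * g -> f = g.
Proof.
move=> k_gt0 /eqP; rewrite -subr_eq0 -mulrBr => /eqP eq0.
have rec : f - g = psX k * (f - g).
  by apply/eqP; rewrite -subr_eq0 -[X in X - _]mul1r -mulrBl eq0.
apply/eqP; rewrite -subr_eq0; apply/eqP; apply: pseriesP => n.
elim/ltn_ind: n => n IHn; rewrite rec psXM; case: leqP => // le_kn.
by rewrite IHn ?ps0 //; lia.
Qed.

End SeriesRing.

(** * Overpartitions *)

Section Overpartitions.

Local Open Scope nat_scope.

Definition weight (s : seq nat) : nat := 2 ^ size (undup s).

Lemma size_subseqs s : size (subseqs s) = 2 ^ size s.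
Proof.
by elim: s => //= x s IHs; rewrite size_cat size_map IHs expnS mul2n addnn.
Qed.

Lemma parts_bounded_fuel a b n m : n <= a -> n <= b ->
  parts_bounded a n m = parts_bounded b n m.
Proof.
elim: a b n m => [|a IHa] [|b] n m //= le_na le_nb.
- by move: le_na; rewrite leqn0 => /eqP ->.
- by move: le_nb; rewrite leqn0 => /eqP ->.
case: eqP => // /eqP n_neq0; congr flatten; apply/eq_in_map => k.
rewrite mem_iota => /andP [k_gt0 _].
by congr (map _ _); apply: IHa; lia.
Qed.

Lemma parts_bounded_leq a n m s x :
  s \in parts_bounded a n m -> x \in s -> x <= m.
Proof.
elim: a n m s => [|a IHa] n m s /=; first by case: ifP => //; rewrite inE => _ /eqP ->.
case: ifP => [_|_]; first by rewrite inE => /eqP ->.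
move=> /flattenP [l /mapP [k]]; rewrite mem_iota => k_le -> /mapP [t t_in ->].
by rewrite inE => /orP [/eqP -> | /(IHa _ _ _ t_in)]; lia.
Qed.

Lemma big_parts_bounded_recr (F : seq nat -> nat) n m :
  \sum_(s <- parts_bounded n n m.+1) F s =
  \sum_(s <- parts_bounded n n m) F s +
  (if m < n then \sum_(s <- parts_bounded (n - m.+1) (n - m.+1) m.+1) F (m.+1 :: s)
   else 0).
Proof.
case: n => [|n] /=; first by rewrite addn0.
rewrite !big_flatten !big_map /=; case: ifP => [lt_mn | /negbT le_nm].
  have [-> ->] : minn n.+1 m.+1 = m + 1 /\ minn n.+1 m = m by lia.
  rewrite iotaD big_cat /= big_seq1 add1n big_map; congr addn.
  by rewrite (parts_bounded_fuel (b := n - m)) // subSS leq_subr.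
have [-> ->] : minn n.+1 m.+1 = n.+1 /\ minn n.+1 m = n.+1 by lia.
by rewrite addn0.
Qed.

(** The number of overpartitions of n into parts at most m: each distinct part of a partition gives
    a factor 2 in [weight]. *)
Definition wsum (n m : nat) : nat := \sum_(s <- parts_bounded n n m) weight s.

Lemma wsum_0r n : wsum n 0 = (n == 0).
Proof. by case: n => [|n]; rewrite /wsum /= ?minn0 ?big_seq1 ?big_nil. Qed.

Lemma weight_cons k s : weight (k :: s) = (if k \in s then 1 else 2) * weight s.
Proof. by rewrite /weight /=; case: ifP => _; rewrite ?mul1n //= expnS. Qed.

(** Remove one copy of a largest part m + 1. The weight halves if no other copy remains and is
    unchanged otherwise, so the rest is counted by 2 [wsum] at m plus the partitions that still
    contain m + 1. *)
Lemma wsum_recr n m :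
  wsum n m.+1 = wsum n m +
    (if m < n then wsum (n - m.+1) m + wsum (n - m.+1) m.+1 else 0).
Proof.
rewrite /wsum big_parts_bounded_recr; congr addn; case: ltnP => // lt_mn.
move: (n - m.+1) => {lt_mn} j.
rewrite big_parts_bounded_recr [in RHS]big_parts_bounded_recr addnA addnn -mul2n.
congr addn; last first.
  by case: ifP => // _; apply: eq_bigr => s _; rewrite weight_cons mem_head mul1n.
rewrite big_distrr /= big_seq [RHS]big_seq; apply: eq_bigr => s s_in.
rewrite weight_cons; case: ifP => // /(parts_bounded_leq s_in); lia.
Qed.

Lemma pbar_wsum n m : n <= m -> pbar n = wsum n m.
Proof.
move=> le_nm; rewrite -(subnKC le_nm); elim: (m - n) => [|k IHk].
  rewrite addn0 /pbar size_flatten /shape -map_comp sumnE big_map.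
  by apply: eq_bigr => s _; rewrite /= size_map size_subseqs.
by rewrite addnS wsum_recr IHk ltnNge leq_addr addn0.
Qed.

End Overpartitions.

(** * Gauss's identity *)

Section Gauss.
Variable R : comNzRingType.

Local Notation X := (psX R).

(* prod_(1 <= k <= m) (1 + q^k) / (1 - q^k) *)
Definition wser (m : nat) : pseries R := PSeries (fun n => (wsum n m)%:R).

Definition pbar_ser : pseries R := PSeries (fun n => (pbar n)%:R).

Lemma wser0 : wser 0 = 1.
Proof. by apply: pseriesP => n; rewrite ps1 /= wsum_0r. Qed.

Lemma wser_rec m : (1 - X m.+1) * wser m.+1 = (1 + X m.+1) * wser m.
Proof.
apply: pseriesP => n; rewrite mulrBl mulrDl !mul1r psB psD !psXM /= wsum_recr.
by case: ltnP => _; rewrite !natrD /=; ring.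
Qed.

(* The quotient (-1; q)_s / (q; q)_s of q-Pochhammer symbols. *)
Definition dser (s : nat) : pseries R := if s is m.+1 then wser m.+1 + wser m else 1.

Lemma dser_rec s : (1 - X s.+1) * dser s.+1 = (1 + X s) * dser s.
Proof.
rewrite /= mulrDr wser_rec; case: s => [|s] /=; first by rewrite wser0 psX0; ring.
have -> : (1 + X s.+1) * (wser s.+1 + wser s) =
  (1 + X s.+1) * wser s.+1 + (1 + X s.+1) * wser s by ring.
by rewrite -(wser_rec s); ring.
Qed.

Fixpoint theta_sum (n : nat) : pseries R :=
  if n is m.+1 then theta_sum m + 2%:R * (-1) ^+ n * X (n * n) else 1.

Definition shanks_sum (k n : nat) : pseries R :=
  \sum_(s < n.+1) (-1) ^+ s * dser s * X (s * k).

(* In the generating function f(z) = sum (-1)^s dser_s z^s, the recursion for dser reads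
   (1 - z) f(qz) = (1 + z) f(z); here z = q^k and the sums are truncated. *)
Lemma shanks_sum_shift k n :
  (1 - X k) * shanks_sum k.+1 n = (1 + X k) * shanks_sum k n
    - (-1) ^+ n * (1 + X n) * dser n * X (n.+1 * k).
Proof.
rewrite /shanks_sum; elim: n => [|n IHn].
  by rewrite !big_ord1 /= mul0n mul1n !psX0 expr0; ring.
rewrite big_ord_recr /= mulrDr IHn [in RHS]big_ord_recr /=.
rewrite [(1 + X k) * (_ + _)]mulrDr.
have -> : X (n.+1 * k.+1) = X (n.+1) * X (n.+1 * k) by rewrite -psXD mulnS.
have -> : X (n.+2 * k) = X k * X (n.+1 * k) by rewrite -psXD mulSn.
have := dser_rec n; rewrite -/(dser n.+1) => eD.
have -> : (-1) ^+ n * (1 + X n) * dser n * X (n.+1 * k) =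
  (-1) ^+ n * ((1 - X n.+1) * dser n.+1) * X (n.+1 * k) by rewrite eD; ring.
by rewrite exprS; move: (dser n.+1) => d; ring.
Qed.

(* Shanks's finite form of Gauss's identity. *)
Lemma shanks n : wser n * theta_sum n = shanks_sum n.+1 n.
Proof.
elim: n => [|n IHn].
  by rewrite wser0 /shanks_sum big_ord1 /= mul0n psX0; ring.
apply: (@ps_subXI _ n.+1) => //.
rewrite mulrA wser_rec shanks_sum_shift /shanks_sum big_ord_recr.
rewrite -/(shanks_sum n.+1 n) -IHn [(n.+2 * n.+1)%N]mulSn psXD.
(* The last summand and the boundary term of [shanks_sum_shift] together carry the factor (1 -
   q^(n+1)) [dser] (n+1); its value 2 [wser] n produces the new term of [theta_sum]. *)
have eD : (1 - X n.+1) * dser n.+1 = 2%:R * wser n by rewrite /= mulrDr wser_rec; ring.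
rewrite [theta_sum n.+1]/=; move: (dser n.+1) eD => d eD.
have -> : (1 + X n.+1) * wser n * (theta_sum n + 2%:R * (-1) ^+ n.+1 * X (n.+1 * n.+1)) =
  (1 + X n.+1) * (wser n * theta_sum n)
    + (2%:R * wser n) * ((1 + X n.+1) * (-1) ^+ n.+1 * X (n.+1 * n.+1)) by ring.
by rewrite -eD /=; ring.
Qed.

End Gauss.

(** * The theta series as inverse of the overpartition series *)

Section Theta.
Variable R : comNzRingType.

Local Notation X := (psX R).
Local Notation theta_sum := (theta_sum R).
Local Notation pbar_ser := (pbar_ser R).

Lemma ps_signM k (f : pseries R) n : ((-1) ^+ k * f) n = (-1) ^+ k * f n.
Proof.
by elim: k f n => [|k IHk] f n; rewrite ?expr0 ?mul1r // !exprS !mulN1r !mulNr psN IHk.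
Qed.

Definition theta : pseries R := PSeries (fun n => theta_sum n n).

(** The term of index j lives in degree j^2 >= j, so partial sums beyond n no longer change the
    coefficient of q^n. *)
Lemma theta_sum_coef k n : (n <= k)%N -> theta_sum k n = theta n.
Proof.
move=> le_nk; rewrite -(subnKC le_nk); elim: (k - n)%N => [|j IHj]; first by rewrite addn0.
rewrite addnS [theta_sum _.+1]/= psD IHj mulrC psXM.
rewrite ifF ?addr0 //.
by have := leq_pmulr (n + j).+1 (ltn0Sn (n + j)); lia.
Qed.

(** Up to degree n both factors agree with their finite forms at level n. In [shanks_sum] the term s
    has degree at least s (n+1) > n unless s = 0, so only the constant 1 survives. *)
Lemma gauss : theta * pbar_ser = 1.
Proof.
apply: pseriesP => n; rewrite mulrC.
rewrite (psM_ext (f' := wser R n) (g' := theta_sum n)).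
- rewrite shanks /shanks_sum big_ord_recl mul0n psX0 expr0 !mul1r psD ps_sum big1 ?addr0 //.
  move=> i _; rewrite mulrC psXM lift0; rewrite ifF // mulSn; lia.
- by move=> k le_kn; rewrite /= (pbar_wsum le_kn).
- by move=> k le_kn; rewrite theta_sum_coef.
Qed.

End Theta.

(** * Representations by one and two squares *)

(** The integers of absolute value at most k, listed in pairs of opposite sign to match the factor 2
    in [theta_sum]. *)
Fixpoint box (k : nat) : seq int :=
  if k is j.+1 then [:: (k%:Z), (- k%:Z) & box j] else [:: 0].

Lemma mem_box k (x : int) : (x \in box k) = (`|x| <= k)%N.
Proof.
elim: k => [|k IHk]; first by rewrite inE; lia.
by rewrite !inE IHk; lia.
Qed.

Lemma uniq_box k : uniq (box k).
Proof. by elim: k => [|k IHk] //=; rewrite !inE !mem_box IHk; lia. Qed.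

(** The search range [box n] misses no root, because |x| <= x^2. *)
Definition sqrts (n : nat) : seq int := [seq x <- box n | (`|x| * `|x| == n)%N].

Definition two_squares (n : nat) : seq (int * int) :=
  [seq p <- allpairs pair (box n) (box n) | (`|p.1| * `|p.1| + `|p.2| * `|p.2| == n)%N].

Lemma mem_sqrts n x : (x \in sqrts n) = (`|x| * `|x| == n)%N.
Proof. by rewrite mem_filter mem_box; case: eqP => //=; nia. Qed.

Lemma mem_two_squares n p :
  (p \in two_squares n) = (`|p.1| * `|p.1| + `|p.2| * `|p.2| == n)%N.
Proof.
case: p => x y; rewrite mem_filter /=; case: eqP => //= exy.
by apply/allpairsP; exists (x, y); rewrite !mem_box; split => //=; nia.
Qed.

Lemma uniq_sqrts n : uniq (sqrts n).
Proof. by rewrite filter_uniq ?uniq_box. Qed.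

Lemma uniq_two_squares n : uniq (two_squares n).
Proof.
by rewrite filter_uniq // allpairs_uniq ?uniq_box // => -[x y] [x' y'] _ _ [-> ->].
Qed.

Lemma size_image (S T : eqType) (f : S -> T) (s : seq S) (t : seq T) :
    injective f -> uniq s -> uniq t ->
    (forall x, x \in s -> f x \in t) ->
    (forall y, y \in t -> exists2 x, x \in s & y = f x) ->
  size t = size s.
Proof.
move=> f_inj us ut fs ft; rewrite -(size_map f s); apply/perm_size/uniq_perm => //.
  by rewrite map_inj_uniq.
move=> y; apply/idP/idP => [/ft [x xs ->] | /mapP [x xs ->]]; last exact: fs.
exact: map_f.
Qed.

Lemma size_sqrts25 n : size (sqrts (25 * n)) = size (sqrts n).
Proof.
apply: (@size_image _ _ (fun x : int => 5 * x)); rewrite ?uniq_sqrts //.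
- by move=> x y; lia.
- by move=> x; rewrite !mem_sqrts => /eqP <-; apply/eqP; nia.
move=> y; rewrite mem_sqrts => /eqP ey.
have : (5 %| `|y| * `|y|)%N by rewrite ey; lia.
rewrite Euclid_dvdM // orbb => dvd5y; exists (y %/ 5)%Z; last by lia.
have e5 : (`|y| = 5 * `|(y %/ 5)%Z|)%N by lia.
by rewrite mem_sqrts; rewrite e5 in ey; apply/eqP; lia.
Qed.

Lemma sqrts5_nil n : ~~ (5 %| n)%N -> sqrts (5 * n) = [::].
Proof.
move=> ndvd; case E : (sqrts _) => [//|x s].
have : x \in sqrts (5 * n) by rewrite E mem_head.
rewrite mem_sqrts => /eqP ex.
have : (5 %| `|x| * `|x|)%N by rewrite ex dvdn_mulr.
rewrite Euclid_dvdM // orbb => /dvdnP [k ek]; case/negP: ndvd.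
by apply/dvdnP; exists (k * k)%N; rewrite ek in ex; nia.
Qed.

Lemma sqrts_mod5 n : sqrts n != [::] -> (n %% 5)%N \in [:: 0; 1; 4]%N.
Proof.
case E : (sqrts n) => [//|x s] _.
have : x \in sqrts n by rewrite E mem_head.
rewrite mem_sqrts => /eqP <-; rewrite -modnMm.
by have := ltn_pmod `|x| (isT : 0 < 5)%N; case: (`|x| %% 5)%N => [|[|[|[|[|]]]]].
Qed.

Lemma two_squaresE n x y : ((x, y) \in two_squares n) = (x * x + y * y == n%:Z).
Proof. by rewrite mem_two_squares /=; lia. Qed.

Lemma mem_two_squares_filter P n x y :
  ((x, y) \in [seq p <- two_squares n | P p]) = P (x, y) && (x * x + y * y == n%:Z).
Proof. by rewrite mem_filter two_squaresE. Qed.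

(* The Gaussian integers of norm [5 n] divisible by [2 + i], resp. by [2 - i]. *)
Lemma size_two_squares_dvd n :
  size [seq p <- two_squares (5 * n) | (5 %| p.1 - 2 * p.2)%Z] = size (two_squares n).
Proof.
(* Multiplication by 2 + i on pairs u + iv. *)
apply: (@size_image _ _ (fun p : int * int => (2 * p.1 - p.2, p.1 + 2 * p.2))).
- by move=> [u v] [u' v'] [] /= *; congr pair; lia.
- exact: uniq_two_squares.
- exact/filter_uniq/uniq_two_squares.
- move=> [u v]; rewrite mem_two_squares_filter two_squaresE /= => /eqP e; apply/andP; split.
    by lia.
  by apply/eqP; lia.
move=> [x y]; rewrite mem_two_squares_filter /= => /andP [/dvdzP [t et] /eqP e].
(* The quotient (x + iy) (2 - i) / 5, where x - 2y = 5t. *)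
exists (y + 2 * t, - t); last by congr pair; rewrite /=; lia.
have ex : x = 2 * y + t * 5 by lia.
by rewrite two_squaresE; apply/eqP; rewrite ex in e; lia.
Qed.

(** Complex conjugation exchanges the two divisibility conditions. *)
Lemma size_two_squares_dvdN n :
  size [seq p <- two_squares (5 * n) | (5 %| p.1 + 2 * p.2)%Z] = size (two_squares n).
Proof.
rewrite -size_two_squares_dvd.
apply: (@size_image _ _ (fun p : int * int => (p.1, - p.2))).
- by move=> [u v] [u' v'] [] /= *; congr pair; lia.
- exact: filter_uniq (uniq_two_squares _).
- exact/filter_uniq/uniq_two_squares.
- move=> [u v]; rewrite !mem_two_squares_filter /= => /andP [? ?].
  by apply/andP; split; lia.
move=> [x y]; rewrite mem_two_squares_filter /= => /andP [? ?].
exists (x, - y); last by rewrite /= opprK.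
by rewrite mem_two_squares_filter /=; apply/andP; split; lia.
Qed.

(** Both conditions together force 5 to divide 2x and 4y, hence x and y; dividing by 5 lowers the
    norm from 25n to n. *)
Lemma size_two_squares_dvd25 n :
  size [seq p <- two_squares (25 * n) | (5 %| p.1 - 2 * p.2)%Z && (5 %| p.1 + 2 * p.2)%Z]
  = size (two_squares n).
Proof.
apply: (@size_image _ _ (fun p : int * int => (5 * p.1, 5 * p.2))).
- by move=> [u v] [u' v'] [] /= *; congr pair; lia.
- exact: uniq_two_squares.
- exact/filter_uniq/uniq_two_squares.
- move=> [u v]; rewrite mem_two_squares_filter two_squaresE /= => /eqP e; apply/andP; split.
    by lia.
  by apply/eqP; lia.
move=> [x y]; rewrite mem_two_squares_filter /= => /andP [d /eqP e].
have [t et] : exists t, x = 5 * t by exists (x %/ 5)%Z; lia.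
have [u eu] : exists u, y = 5 * u by exists (y %/ 5)%Z; lia.
by subst x y; exists (t, u) => //; rewrite two_squaresE; lia.
Qed.

(** Inclusion-exclusion: a Gaussian integer of norm 5n is divisible by 2 + i or 2 - i, and by both
    exactly when it is divisible by 5. *)
Lemma size_two_squares5 n :
  (size (two_squares (5 * n)) + (if 5 %| n then size (two_squares (n %/ 5)) else 0)
  = 2 * size (two_squares n))%N.
Proof.
set P1 : pred (int * int) := fun p => (5 %| p.1 - 2 * p.2)%Z.
set P2 : pred (int * int) := fun p => (5 %| p.1 + 2 * p.2)%Z.
have eU : size (two_squares (5 * n)) = count (predU P1 P2) (two_squares (5 * n)).
  symmetry; apply/eqP; rewrite -all_count; apply/allP => -[x y].
  rewrite two_squaresE /= /P1 /P2 /= => /eqP e.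
  (* The product is x^2 + y^2 - 5 y^2 = 5 (n - y^2). *)
  have : (5 %| (x - 2 * y) * (x + 2 * y))%Z.
    by apply/dvdzP; exists (n%:Z - y * y); lia.
  by rewrite !dvdzE abszM Euclid_dvdM.
rewrite eU mul2n -addnn -{1}(size_two_squares_dvd n) -(size_two_squares_dvdN n).
rewrite [in RHS]size_filter [in RHS]size_filter.
rewrite -/P1 -/P2 -(count_predUI P1 P2); congr addn; case: ifP => [/dvdnP [m ->] | ndvd].
  rewrite mulnK // -size_two_squares_dvd25 size_filter mulnCA mulnC mulnA.
  by [].
(* An element satisfying both conditions would give 25 | 5n, contrary to 5 not dividing n. *)
symmetry; apply/eqP; rewrite eqn0Ngt -has_count; apply/hasP => -[[x y]].
rewrite two_squaresE /P1 /P2 /= => /eqP e d.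
have [t et] : exists t, x = 5 * t by exists (x %/ 5)%Z; lia.
have [u eu] : exists u, y = 5 * u by exists (y %/ 5)%Z; lia.
by subst x y; case/negP: (negbT ndvd); apply/dvdnP; exists (absz (t * t + u * u)); lia.
Qed.

(** * Coefficients of theta and its square as signed representation numbers *)

Section ThetaCoef.
Variable R : comNzRingType.

Local Notation X := (psX R).

Lemma theta_sum_box k :
  theta_sum R k = \sum_(x <- box k) (-1) ^+ `|x|%N * X (`|x| * `|x|)%N.
Proof.
elim: k => [|k IHk]; first by rewrite big_seq1 mul1r.
by rewrite !big_cons -IHk /=; ring.
Qed.

(** Makes the sign of each term depend only on its exponent, so it factors out of a whole
    coefficient. *)
Lemma sign_sqr a : (-1) ^+ (a * a) = (-1) ^+ a :> R.
Proof. by rewrite -signr_odd oddM andbb signr_odd. Qed.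

Lemma theta_coef n : theta R n = (-1) ^+ n * (size (sqrts n))%:R.
Proof.
have -> : theta R n = theta_sum R n n by [].
rewrite theta_sum_box ps_sum size_filter -sum1_count natr_sum mulr_sumr.
rewrite [RHS]big_mkcond; apply: eq_bigr => x _; rewrite ps_signM psXE eq_sym.
by case: eqP => [<-|]; rewrite ?mulr0 // sign_sqr.
Qed.

Lemma theta2_coef n : (theta R ^+ 2) n = (-1) ^+ n * (size (two_squares n))%:R.
Proof.
rewrite expr2 (psM_ext (f' := theta_sum R n) (g' := theta_sum R n));
  try by move=> k le_kn; rewrite theta_sum_coef.
rewrite theta_sum_box mulr_suml ps_sum size_filter -sum1_count natr_sum mulr_sumr.
rewrite [RHS]big_mkcond big_allpairs; apply: eq_bigr => x _.
rewrite mulr_sumr ps_sum; apply: eq_bigr => y _.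
rewrite mulrACA -exprD -psXD ps_signM psXE eq_sym.
by case: eqP => [<-|]; rewrite ?mulr0 // 2!exprD !sign_sqr.
Qed.

End ThetaCoef.

(** * Dissection modulo 5 *)

Section Dissection.
Variable R : comNzRingType.
Implicit Types f g h : pseries R.

Definition restr (r : nat) f : pseries R :=
  PSeries (fun n => if (n %% 5 == r)%N then f n else 0).

Lemma restrE r f n : restr r f n = if (n %% 5 == r)%N then f n else 0.
Proof. by []. Qed.

Definition homog (r : nat) f := forall n, (n %% 5 != r)%N -> f n = 0.

(** The substitution f(q^5). *)
Definition expand f : pseries R :=
  PSeries (fun n => if (5 %| n)%N then f (n %/ 5)%N else 0).

Lemma expandE f n : expand f n = if (5 %| n)%N then f (n %/ 5)%N else 0.
Proof. by []. Qed.

Lemma homogM r s f g : homog r f -> homog s g -> homog ((r + s) %% 5) (f * g).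
Proof.
move=> hf hg n ne; rewrite psM big1 // => i _; have := ltn_ord i => lt_i.
have [ei|/hf ->] := eqVneq (i %% 5)%N r; last by rewrite mul0r.
have [ej|/hg ->] := eqVneq ((n - i) %% 5)%N s; last by rewrite mulr0.
by case/eqP: ne; rewrite -ei -ej modnDm subnKC.
Qed.

Lemma homogD r f g : homog r f -> homog r g -> homog r (f + g).
Proof. by move=> hf hg n ne; rewrite psD hf // hg // addr0. Qed.

Lemma homog_natl r m f : homog r f -> homog r (m%:R * f).
Proof.
move=> hf; rewrite mulr_natl; elim: m => [|m IHm] //; rewrite mulrS.
exact: homogD.
Qed.

Lemma homog_restr r f : homog r (restr r f).
Proof. by move=> n /negPf /= ->. Qed.

Lemma restrD r f g : restr r (f + g) = restr r f + restr r g.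
Proof. by apply: pseriesP => n; rewrite psD /=; case: ifP; rewrite ?addr0. Qed.

Lemma restr_homog r s f : homog s f -> restr r f = if r == s then f else 0.
Proof.
move=> hf; apply: pseriesP => n; rewrite restrE.
have [->|ne] := eqVneq r s; first by case: eqVneq => // /hf ->.
by case: eqP => // en; rewrite hf // en.
Qed.

Lemma restr_coef r f g n : (n %% 5)%N = r -> restr r f = restr r g -> f n = g n.
Proof. by move=> en /(congr1 (fun h : pseries R => h n)); rewrite /= en eqxx. Qed.

Lemma restr_natl r m f : restr r (m%:R * f) = m%:R * restr r f.
Proof.
rewrite !mulr_natl; elim: m => [|m IHm]; last by rewrite !mulrS restrD IHm.
by apply: pseriesP => n; rewrite /= if_same.
Qed.

(** The exponents of f(q^5) are multiples of 5, so multiplying by it preserves residue classes. *)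
Lemma restr_expandM r f g : restr r (expand f * g) = expand f * restr r g.
Proof.
apply: pseriesP => n; rewrite restrE !psM; case: eqP => en.
  apply: eq_bigr => i _; rewrite /=; case: ifP => dvd_i; rewrite ?mul0r //.
  by rewrite ifT //; have := ltn_ord i; lia.
rewrite big1 // => i _ /=; case: ifP => dvd_i; rewrite ?mul0r //.
by rewrite ifF ?mulr0 //; have := ltn_ord i; lia.
Qed.

Lemma expand_coef f n : expand f (5 * n)%N = f n.
Proof. by rewrite /= dvdn_mulr // mulKn. Qed.

Lemma restr_expand f : restr 0 (expand f) = expand f.
Proof. by rewrite (restr_homog _ (s := 0)) // => n ne /=; rewrite /dvdn (negPf ne). Qed.

Lemma restr_expand_coef f g n : restr 0 f = expand g -> f (5 * n)%N = g n.
Proof.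
move=> e; rewrite -(expand_coef g); apply: (@restr_coef 0); first by rewrite modnMr.
by rewrite e restr_expand.
Qed.

End Dissection.

(** * Fifth powers over the field with five elements *)

Local Notation F5 := 'F_5.

Lemma ps5 : 5%:R = 0 :> pseries F5.
Proof.
apply: pseriesP => n; rewrite ps_natr ps0 -mulr_natr.
by rewrite (pcharf0 (pchar_Fp (isT : prime 5))) mulr0.
Qed.

Lemma F5_exp5 (c : F5) : c ^+ 5 = c.
Proof. by case: c => -[|[|[|[|[|]]]]] // lt; apply: val_inj. Qed.

(** Split off the constant term, f = c + q g. In characteristic 5 this gives f^5 = c + q^5 g^5, and
    strong induction applies to g^5 in degree n - 5. *)
Lemma ps_exp5 (f : pseries F5) : f ^+ 5 = expand f.
Proof.
apply: pseriesP => n; elim/ltn_ind: n f => n IHn f.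
pose g : pseries F5 := PSeries (fun k => f k.+1).
pose c : pseries F5 := PSeries (fun k => if (k == 0)%N then f 0%N else 0).
have ef : f = c + psX _ 1 * g.
  by apply: pseriesP => -[|k]; rewrite psD psXM /= ?addr0 // add0r subn1.
have ec : c ^+ 5 = c.
  have cM (a b : F5) : PSeries (fun k => if (k == 0)%N then a else 0) *
     PSeries (fun k => if (k == 0)%N then b else 0) =
     PSeries (fun k => if (k == 0)%N then a * b else 0) :> pseries F5.
    apply: pseriesP => k; rewrite psM big_ord_recl /= big1 => [|i _].
      by rewrite subn0 addr0; case: eqP; rewrite ?mulr0.
    by rewrite mul0r.
  by rewrite !exprS expr0 mulr1 /c !cM -[in RHS](F5_exp5 (f 0%N)) !exprS expr0 mulr1.
have -> : f ^+ 5 = c ^+ 5 + psX _ 5 * g ^+ 5.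
  have -> : psX _ 5 = psX F5 1 ^+ 5 by rewrite psXX.
  rewrite {1}ef -exprMn; move: (psX _ 1 * g) => y.
  have -> : (c + y) ^+ 5 = c ^+ 5 + y ^+ 5 + 5%:R *
    (c ^+ 4 * y + 2%:R * c ^+ 3 * y ^+ 2 + 2%:R * c ^+ 2 * y ^+ 3 + c * y ^+ 4) by ring.
  by rewrite ps5 mul0r addr0.
rewrite ec psD psXM; case: (leqP 5 n) => [le5n | lt_n5].
  rewrite IHn /=; last by lia.
  have -> : (n == 0)%N = false by lia.
  have -> : (5 %| n - 5)%N = (5 %| n)%N by lia.
  rewrite add0r; case: ifP => // dvd_n; congr (f _); lia.
by rewrite addr0; case: n IHn lt_n5 => [|[|[|[|[|]]]]].
Qed.

(** * Dissections of powers of theta and the congruences *)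

Section Mod5.

Local Notation theta := (theta F5).
Local Notation P := (pbar_ser F5).
Local Notation V := (@expand F5).
Local Notation T := (@restr F5).

(** Over F_5 the substitution is the fifth power map, which is multiplicative. *)
Lemma expandM (f g : pseries F5) : V (f * g) = V f * V g.
Proof. by rewrite -!ps_exp5 exprMn. Qed.

Lemma expandX (f : pseries F5) n : V (f ^+ n) = V f ^+ n.
Proof. by rewrite -!ps_exp5 exprAC. Qed.

Lemma expandB (f g : pseries F5) : V (f - g) = V f - V g.
Proof.
by apply: pseriesP => n; rewrite psB /=; case: ifP; rewrite ?subr0.
Qed.

Lemma expand_natl m (f : pseries F5) : V (m%:R * f) = m%:R * V f.
Proof.
rewrite !mulr_natl; elim: m => [|m IHm].
  by apply: pseriesP => n; rewrite /= if_same.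
by rewrite !mulrS -IHm; apply: pseriesP => n; rewrite psD /=; case: ifP; rewrite ?addr0.
Qed.

Lemma theta_split : theta = T 0%N theta + T 1%N theta + T 4%N theta.
Proof.
apply: pseriesP => n; rewrite !psD !restrE.
have [n0|/sqrts_mod5] := eqVneq (sqrts n) [::].
  by rewrite theta_coef n0 mulr0 !if_same !addr0.
by rewrite !inE => /or3P [] /eqP -> /=; rewrite ?addr0 ?add0r.
Qed.

(** If 5 divides x^2 then x = 5y, so the exponent is 25 y^2; the sign is kept because 5 is odd. *)
Lemma restr0_theta : T 0%N theta = V (V theta).
Proof.
apply: pseriesP => n; rewrite restrE !expandE -[(_ == 0)%N]/(dvdn 5 n).
case: ifP => // /dvdnP [m ->]; rewrite mulnK // !theta_coef mulnC.
case: ifP => [/dvdnP [k ->] | ndvd]; last by rewrite sqrts5_nil ?ndvd // mulr0.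
have -> : (5 * (k * 5) = 25 * k)%N by lia.
rewrite mulnK // size_sqrts25.
by rewrite -signr_odd oddM /= signr_odd.
Qed.

(** Coefficient form of [size_two_squares5]; the signs at 5m, m and m/5 coincide. *)
Lemma restr0_theta2 : T 0%N (theta ^+ 2) = 2%:R * V theta ^+ 2 - V (V theta) ^+ 2.
Proof.
rewrite -!expandX -expand_natl -expandB; apply: pseriesP => n.
rewrite restrE expandE -[(_ == 0)%N]/(dvdn 5 n).
case: ifP => // /dvdnP [m ->]; rewrite mulnK // mulnC psB mulr_natl mulr2n psD.
have e := congr1 (fun k : nat => k%:R : F5) (size_two_squares5 m).
have sgn : (-1) ^+ (5 * m) = (-1) ^+ m :> F5 by rewrite -signr_odd oddM /= signr_odd.
rewrite !theta2_coef sgn expandE; move: e; rewrite natrD mul2n -addnn natrD.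
case: ifP => [/dvdnP [k ->] | _].
  rewrite mulnK // theta2_coef [(k * 5)%N]mulnC.
  have -> : (-1) ^+ (5 * k) = (-1) ^+ k :> F5 by rewrite -signr_odd oddM /= signr_odd.
  by rewrite -!mulrDr => <-; ring.
by rewrite addr0 subr0 -mulrDr => <-.
Qed.

Local Notation F := (V theta).
Local Notation t0 := (T 0%N theta).
Local Notation t1 := (T 1%N theta).
Local Notation t4 := (T 4%N theta).

(** Monomials in the components of theta. Their exponents lie in the class of b + 4d modulo 5, by
    which multinomial expansions are sorted below. *)
Definition mono (c a b d : nat) : pseries F5 := c%:R * (t0 ^+ a * t1 ^+ b * t4 ^+ d).

Lemma homogX r (f : pseries F5) n : homog r f -> homog ((n * r) %% 5) (f ^+ n).
Proof.
move=> hf; elim: n => [|n IHn].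
  by move=> k ne; rewrite expr0 ps1; case: k ne.
by rewrite exprS; have := homogM hf IHn; rewrite modnDmr mulSn.
Qed.

Lemma homog_mono r c a b d : ((b + d * 4) %% 5 = r)%N -> homog r (mono c a b d).
Proof.
move=> <-; apply: homog_natl.
have := @homogX _ _ a (@homog_restr F5 0 theta); rewrite muln0 => h0.
have h1 := @homogX _ _ b (@homog_restr F5 1 theta).
have h4 := @homogX _ _ d (@homog_restr F5 4 theta).
by have := homogM (homogM h0 h1) h4; rewrite add0n modn_mod modnDm muln1.
Qed.

Lemma restr_decomp r (f g0 g1 g2 g3 g4 : pseries F5) : f = g0 + g1 + g2 + g3 + g4 ->
  homog 0 g0 -> homog 1 g1 -> homog 2 g2 -> homog 3 g3 -> homog 4 g4 -> (r < 5)%N ->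
  T r f = nth 0 [:: g0; g1; g2; g3; g4] r.
Proof.
move=> -> k0 k1 k2 k3 k4; rewrite !restrD (restr_homog _ k0) (restr_homog _ k1).
rewrite (restr_homog _ k2) (restr_homog _ k3) (restr_homog _ k4).
by case: r => [|[|[|[|[|]]]]] // _ /=; rewrite ?addr0 ?add0r.
Qed.

Ltac homogs := repeat apply: homogD; exact: homog_mono.

Lemma restr_theta2 : T 0%N (theta ^+ 2) = mono 1 2 0 0 + mono 2 0 1 1.
Proof.
rewrite (@restr_decomp _ _ (mono 1 2 0 0 + mono 2 0 1 1) (mono 2 1 1 0) (mono 1 0 2 0)
  (mono 1 0 0 2) (mono 2 1 0 1)) //; try homogs.
by rewrite {1}theta_split /mono; ring.
Qed.

Lemma restr_theta3 r : (r < 5)%N -> T r (theta ^+ 3) = nth 0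
  [:: mono 1 3 0 0 + mono 6 1 1 1; mono 3 2 1 0 + mono 3 0 2 1;
      mono 3 1 2 0 + mono 1 0 0 3; mono 1 0 3 0 + mono 3 1 0 2;
      mono 3 2 0 1 + mono 3 0 1 2] r.
Proof.
move=> lt_r; apply: restr_decomp => //; try homogs.
by rewrite {1}theta_split /mono; ring.
Qed.

Lemma restr_theta4 :
  T 0%N (theta ^+ 4) = mono 1 4 0 0 + mono 12 2 1 1 + mono 6 0 2 2.
Proof.
rewrite (@restr_decomp _ _ (mono 1 4 0 0 + mono 12 2 1 1 + mono 6 0 2 2)
  (mono 4 3 1 0 + mono 12 1 2 1 + mono 1 0 0 4)
  (mono 6 2 2 0 + mono 4 0 3 1 + mono 4 1 0 3)
  (mono 4 1 3 0 + mono 6 2 0 2 + mono 4 0 1 3)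
  (mono 1 0 4 0 + mono 4 3 0 1 + mono 12 1 1 2)) //; try homogs.
by rewrite {1}theta_split /mono; ring.
Qed.

Lemma t1t4 : t1 * t4 = F ^+ 2 - t0 ^+ 2.
Proof.
have := restr0_theta2; rewrite restr_theta2 /mono -restr0_theta => e.
have e2 : 2%:R * (t1 * t4) = 2%:R * (F ^+ 2 - t0 ^+ 2).
  have -> : 2%:R * (t1 * t4) = (1%:R * (t0 ^+ 2 * t1 ^+ 0 * t4 ^+ 0) +
    2%:R * (t0 ^+ 0 * t1 ^+ 1 * t4 ^+ 1)) - t0 ^+ 2 by ring.
  by rewrite e; ring.
(* Since 6 = 1 modulo 5, multiplication by 3 cancels the factor 2. *)
have half (x : pseries F5) : x = 3%:R * (2%:R * x).
  have -> : 3%:R * (2%:R * x) = x + 5%:R * x by ring.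
  by rewrite ps5 mul0r addr0.
by rewrite [LHS]half e2 -half.
Qed.

Lemma pbar5 n : P (5 * n)%N = (theta ^+ 3) n.
Proof.
apply: restr_expand_coef.
have e4 : T 0%N (theta ^+ 4) = F ^+ 4.
  rewrite restr_theta4 /mono.
  have -> : 1%:R * (t0 ^+ 4 * t1 ^+ 0 * t4 ^+ 0) + 12%:R * (t0 ^+ 2 * t1 ^+ 1 * t4 ^+ 1)
    + 6%:R * (t0 ^+ 0 * t1 ^+ 2 * t4 ^+ 2)
    (* Modulo 5 the coefficients 1, 12, 6 are 1, 2, 1, those of a perfect square; its base is F^2 by
       [t1t4]. *)
    = (t0 ^+ 2 + t1 * t4) ^+ 2 + 5%:R * (2%:R * t0 ^+ 2 * (t1 * t4) + (t1 * t4) ^+ 2) by ring.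
  by rewrite ps5 t1t4; ring.
have e : F * P = theta ^+ 4 by rewrite -ps_exp5 exprSr -mulrA gauss mulr1.
have e' : F * T 0%N P = F ^+ 4 by rewrite -restr_expandM e e4.
(* An explicit inverse of F, used to cancel F in [e'] and leave F^3. *)
have Vinv : V P * F = 1 by rewrite -expandM mulrC gauss -ps_exp5 expr1n.
rewrite expandX -[T _ _]mul1r -Vinv -mulrA e' [F ^+ 4]exprS mulrA Vinv.
by rewrite mul1r.
Qed.

Lemma theta3_5 n : (theta ^+ 3) (5 * n)%N = (F * theta ^+ 2) n.
Proof.
apply: restr_expand_coef; rewrite restr_theta3 //= /mono expandM expandX -restr0_theta.
(* As 6 = 1 modulo 5, the sum becomes t0 (t0^2 + t1 t4) = t0 F^2. *)
have -> : 1%:R * (t0 ^+ 3 * t1 ^+ 0 * t4 ^+ 0) + 6%:R * (t0 ^+ 1 * t1 ^+ 1 * t4 ^+ 1)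
  = t0 * (t0 ^+ 2 + t1 * t4) + 5%:R * (t0 * (t1 * t4)) by ring.
by rewrite ps5 t1t4; ring.
Qed.

Lemma theta3_25 n :
  (theta ^+ 3) (25 * n)%N = (2%:R * theta ^+ 3 - theta * F ^+ 2) n.
Proof.
rewrite -[25%N]/(5 * 5)%N -mulnA theta3_5; apply: restr_expand_coef.
rewrite restr_expandM restr0_theta2 expandB expand_natl expandX expandM expandX; ring.
Qed.

Lemma restr_thetaF2 r : T r (theta * F ^+ 2) = T r theta * F ^+ 2.
Proof. by rewrite -expandX mulrC restr_expandM mulrC. Qed.

(** At multiples of 5, theta F^2 and theta^3 have equal coefficients, so the right side of
    [theta3_25] collapses to 2c - c = c. *)
Lemma theta3_125 n : (theta ^+ 3) (125 * n)%N = (theta ^+ 3) (5 * n)%N.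
Proof.
rewrite -[125%N]/(25 * 5)%N -mulnA theta3_25 psB.
have -> : (theta * F ^+ 2) (5 * n)%N = (theta ^+ 3) (5 * n)%N.
  rewrite theta3_5; apply: restr_expand_coef.
  by rewrite restr_thetaF2 restr0_theta expandM expandX.
by rewrite mulr_natl mulr2n psD addrK.
Qed.

(** In both classes the component is 3 t_r (t0^2 + t1 t4), and the bracket is F^2. *)
Lemma restr_theta3F r : r \in [:: 1; 4]%N -> T r (theta ^+ 3) = 3%:R * (T r theta * F ^+ 2).
Proof.
rewrite !inE => /orP [] /eqP ->; rewrite restr_theta3 //= /mono.
  have -> : F ^+ 2 = t0 ^+ 2 + t1 * t4 by rewrite t1t4; ring.
  by ring.
have -> : F ^+ 2 = t0 ^+ 2 + t1 * t4 by rewrite t1t4; ring.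
by ring.
Qed.

Lemma theta3_25_0 n : (n %% 5)%N \in [:: 1; 4]%N -> (theta ^+ 3) (25 * n)%N = 0.
Proof.
move=> n14; rewrite theta3_25 psB.
have -> : (2%:R * theta ^+ 3) n = (2%:R * (3%:R * (theta * F ^+ 2))) n.
  by apply: (restr_coef erefl); rewrite !restr_natl restr_theta3F // restr_thetaF2.
rewrite -psB.
(* The coefficients combine to 2 * 3 - 1 = 5, which is zero in F_5. *)
have -> : 2%:R * (3%:R * (theta * F ^+ 2)) - theta * F ^+ 2 = 5%:R * (theta * F ^+ 2) by ring.
by rewrite ps5 mul0r.
Qed.

Lemma theta3_pow25 a n : (n %% 5)%N \in [:: 1; 4]%N -> (theta ^+ 3) (25 ^ a.+1 * n)%N = 0.
Proof.
move=> n14; elim: a => [|a IHa]; first by rewrite expn1 theta3_25_0.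
rewrite -IHa !expnS.
(* Splitting off 125 leaves a multiple of 5 as required, and [theta3_125] then removes a factor
   25. *)
have -> : (25 * (25 * 25 ^ a) * n = 125 * (5 * 25 ^ a * n))%N by lia.
by rewrite theta3_125; congr (pcoef _ _); lia.
Qed.

Lemma pbar_pow5 a n : (n %% 5)%N \in [:: 1; 4]%N -> (1 <= a)%N ->
  (pbar (5 ^ (2 * a + 1) * n) = 0 %[mod 5])%N.
Proof.
case: a => // a n14 _; have := theta3_pow25 a n14; rewrite -pbar5.
have -> : (5 * (25 ^ a.+1 * n) = 5 ^ (2 * a.+1 + 1) * n)%N.
  by rewrite addn1 [(5 ^ _.+1)%N]expnS expnM mulnA.
rewrite /= => /eqP; rewrite -(dvdn_pcharf (pchar_Fp (isT : prime 5))) => /eqP ->.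
by rewrite mod0n.
Qed.

End Mod5.

Local Close Scope ring_scope.

Theorem theorem3 (alpha n : nat) : 1 <= alpha ->
  pbar (5 ^ (2 * alpha + 1) * (5 * n + 1)) = 0 %[mod 5] /\
  pbar (5 ^ (2 * alpha + 1) * (5 * n + 4)) = 0 %[mod 5].
Proof.
by move=> alpha_gt0; split; apply: pbar_pow5 => //; rewrite mulnC modnMDl.
Qed.
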